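(* Let $G$ be a second countable locally compact Hausdorff group, let $d$ be a proper right-invariant metric on $G$ compatible with its topology, and let $a\in G$. Then the following are equivalent: (1) $a$ is an aperiodic element of $G$. (2) For any compact subsets $K$ and $K'$ of $G$, $d(Ka^{\ell},K')\to\infty$ as $\ell\to\infty$.
   Context: For $a\in G$ let $G(a)=\overline{\langle a\rangle}$ be the closure of the cyclic subgroup generated by $a$. The element $a$ is periodic if $G(a)$ is compact, and aperiodic if it is not periodic. A metric $d$ on $G$ is right-invariant if $d(xg,yg)=d(x,y)$ for all $x,y,g\in G$, compatible if it induces the topology of $G$, and proper if closed bounded sets are compact (so every ball $\{y: d(x,y)<R\}$ is precompact). Every second countable locally compact Hausdorff group admits such a metric. For subsets $S,S'\subseteq G$, $d(S,S')=\inf\{d(s,s'): s\in S, s'\in S'\}$ (with $\inf\varnothing=+\infty$). *)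

(* Defs.v *)
From HB Require Import structures.
From mathcomp Require Import all_boot all_order all_algebra.
From mathcomp Require Import all_classical all_reals all_analysis.

Set Implicit Arguments.
Unset Strict Implicit.
Unset Printing Implicit Defensive.

Import Order.TTheory GRing.Theory Num.Theory.
Import numFieldNormedType.Exports.

Local Open Scope classical_set_scope.
Local Open Scope ring_scope.

(* Multiplicative counterpart of [topologicalZmodType]. No separation axiom is
   included. *)
HB.mixin Record isTopologicalGroup G & Topological G & Group G := {
  mulg_continuous : continuous (fun x : G * G => (x.1 * x.2)%g) ;
  invg_continuous : continuous (fun x : G => (x^-1)%g) ;
}.

#[short(type="topologicalGroupType")]
HB.structure Definition TopologicalGroup :=
  {G of Topological G & Group G & isTopologicalGroup G}.

Definition expgz (G : groupType) (a : G) (z : int) : G :=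
  match z with
  | Posz n => (a ^+ n)%g
  | Negz n => (a ^- n.+1)%g
  end.

(* The library's <[a]> is only available for finite groups. *)
Definition cyclic_subgroup (G : groupType) (a : G) : set G := range (expgz a).

Definition monothetic_subgroup (G : topologicalGroupType) (a : G) : set G :=
  closure (cyclic_subgroup a).

Definition periodic_elt (G : topologicalGroupType) (a : G) : Prop :=
  compact (monothetic_subgroup a).

Definition aperiodic_elt (G : topologicalGroupType) (a : G) : Prop :=
  ~ periodic_elt a.

(* A metric is a separate function here rather than a [metricType] structure on
   the group: the group already carries its topology, and compatibility of the
   two is a hypothesis. The axioms are those of the factory [isMetric]. *)
Definition is_metric (R : realType) (T : Type) (d : T -> T -> R) : Prop :=
  [/\ forall x, d x x = 0,
      forall x y, d x y = 0 -> x = y,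
      forall x y, d x y = d y x &
      forall y x z, d x z <= d x y + d y z].

Definition dball (R : realType) (T : Type) (d : T -> T -> R) (x : T) (r : R)
    : set T :=
  [set y | d x y < r].

Definition compatible_metric (R : realType) (T : topologicalType) (d : T -> T -> R)
    : Prop :=
  forall U : set T,
    open U <-> (forall x, U x -> exists2 r : R, 0 < r & dball d x r `<=` U).

Definition dbounded (R : realType) (T : Type) (d : T -> T -> R) (A : set T)
    : Prop :=
  exists M : R, forall x y, A x -> A y -> d x y <= M.

Definition proper_metric (R : realType) (T : topologicalType) (d : T -> T -> R)
    : Prop :=
  forall A : set T, closed A -> dbounded d A -> compact A.

Definition right_invariant_metric (R : realType) (G : groupType) (d : G -> G -> R)
    : Prop :=
  forall x y g : G, d (x * g)%g (y * g)%g = d x y.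

(* Extended-real valued, so that it is +oo when one of the sets is empty. *)
Definition setdist (R : realType) (T : Type) (d : T -> T -> R) (S S' : set T)
    : \bar R :=
  ereal_inf [set (d s s')%:E | s in S & s' in S'].

Definition rtranslate (G : groupType) (K : set G) (g : G) : set G :=
  [set (k * g)%g | k in K].

(* Main.v *)
(* If d(K a^l, K') does not tend to infinity, some ball around 1 contains a^l
   for infinitely many l ("return times"). Since the ball is totally bounded and
   d(a^m, a^n) = d(a^(m-n), 1), each return time j > N yields a smaller one
   j - n with 1 <= n <= N, where N is fixed; hence return times have bounded
   gaps, all powers of a stay in one ball, and their closure is compact by
   properness. Conversely, for a periodic, take K = {1} and K' = G(a). *)
Require Import Defs.
From mathcomp Require Import all_boot all_order all_algebra.
From mathcomp Require Import all_classical all_reals all_analysis.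
From mathcomp Require Import lra zify.
Import Order.TTheory GRing.Theory Num.Theory.

Local Open Scope classical_set_scope.
Local Open Scope ring_scope.

Section CompatibleMetric.
Context (R : realType) (T : topologicalType) (d : T -> T -> R).
Hypotheses (d_metric : is_metric d) (d_compatible : compatible_metric d).

Lemma nbhs_dball (x : T) (r : R) : 0 < r -> nbhs x (dball d x r).
Proof.
case: d_metric => d0 _ _ dtri r0.
rewrite nbhsE; exists (dball d x r); last by [].
split; last by rewrite /dball /= d0.
apply/(d_compatible (dball d x r)) => y; rewrite /dball /= => dxy.
exists (r - d x y); first by rewrite subr_gt0.
move=> z; rewrite /dball /= => dyz.
by have := dtri y x z; lra.
Qed.

(** On the unit ball around [x] the bound [d x p + 1] works; compactness, in its near-covering form,
    makes one bound serve all of [K]. *)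
Lemma compact_dist_le (K : set T) (p : T) :
  compact K -> exists M : R, forall x, K x -> d x p <= M.
Proof.
case: d_metric => _ _ dC dtri /compact_near_coveringP cK.
have /cK : forall x, K x -> \forall x' \near x & M \near +oo%R, d x' p <= M.
  move=> x Kx.
  exists (dball d x 1, [set M | d x p + 1 <= M]) => /=.
    by split; [exact: nbhs_dball | exact/nbhs_pinfty_ge/num_real].
  case=> y M [/=]; rewrite /dball /= => dxy leM.
  by have := dtri x y p; rewrite (dC y x); lra.
move=> [M [_ HM]].
(* Neighbourhoods of +oo only give values strictly above [M], hence [M + 1]. *)
by exists (M + 1) => x Kx; apply: HM => //; rewrite ltrDl.
Qed.

(** Each point of the closure is within 1 of [A], so within [M + 1] of [p]. *)
Lemma dbounded_closure (A : set T) (p : T) (M : R) :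
  (forall x, A x -> d x p <= M) -> dbounded d (closure A).
Proof.
case: d_metric => _ _ dC dtri AM.
have cAM x : closure A x -> d x p <= M + 1.
  move=> /(_ _ (nbhs_dball x 1 ltr01)) [y []] /AM dyp; rewrite /dball /= => dxy.
  by have := dtri y x p; lra.
exists ((M + 1) + (M + 1)) => x y /cAM dxp /cAM dyp.
by have := dtri p x y; rewrite (dC p y); lra.
Qed.

End CompatibleMetric.

Section RightInvariantMetric.
Context (R : realType) (G : topologicalGroupType) (d : G -> G -> R).
Hypotheses (d_metric : is_metric d) (d_right_invariant : right_invariant_metric d)
  (d_compatible : compatible_metric d) (d_proper : proper_metric d).
Context (a : G).

Lemma dist_expg (m n : nat) :
  (n <= m)%N -> d (a ^+ m)%g (a ^+ n)%g = d (a ^+ (m - n))%g 1%g.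
Proof.
by move=> nm; rewrite -{1}(subnK nm) expgnDr -{2}[(a ^+ n)%g]mul1g d_right_invariant.
Qed.

(* The exponents n come from a finite cover of the closed ball of radius r by
   balls of radius r / 2: keep one positive power of a in each ball. *)
Lemma finite_net_expg (r : R) : 0 < r ->
  exists N : nat, forall j, (0 < j)%N -> d (a ^+ j)%g 1%g <= r ->
    exists n, [/\ (0 < n)%N, (n <= N)%N & d (a ^+ j)%g (a ^+ n)%g <= r].
Proof.
case: d_metric => _ _ dC dtri r0.
set B := [set x | d x 1%g <= r].
have /compact_near_coveringP cB : compact (closure B).
  by apply: d_proper; [exact: closed_closure | exact: (@dbounded_closure _ _ _ _ _ _ 1%g r)].
(* Stated for points [x] rather than exponents, so that near-covering compactness applies; it is
   vacuous off the positive powers of [a]. *)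
pose P (N : nat) x := forall j, (0 < j)%N -> (a ^+ j)%g = x ->
    exists n, [/\ (0 < n)%N, (n <= N)%N & d (a ^+ j)%g (a ^+ n)%g <= r].
have /cB : forall x, closure B x -> \forall x' \near x & N \near \oo, P N x'.
  move=> x _.
  have [[n n0 dxn]|none] := pselect (exists2 n, (0 < n)%N & d x (a ^+ n)%g < r / 2).
    exists (dball d x (r / 2), [set N | (n <= N)%N]) => /=.
      split; last exact: nbhs_infty_ge.
      by apply: nbhs_dball => //; rewrite divr_gt0.
    case=> y N [/=]; rewrite /dball /= => dxy leN j j0 ajy.
    exists n; split=> //.
    by have := dtri x y (a ^+ n)%g; rewrite ajy (dC y x); lra.
  (* This ball contains no positive power of [a], so any [N] will do. *)
  exists (dball d x (r / 2), setT) => /=.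
    split; last exact: filterT.
    by apply: nbhs_dball => //; rewrite divr_gt0.
  case=> y N [/=]; rewrite /dball /= => dxy _ j j0 ajy.
  by case: none; exists j; rewrite // ajy.
move=> [N _ HN].
exists N => j j0 Bj.
by apply: (HN N _ (a ^+ j)%g) => //=; apply: subset_closure.
Qed.

(* From a return time j > k + N, subtracting some n <= N gives another return
   time, so return times occur in every window of length N. *)
Lemma dist_expg_bounded (r : R) :
  (forall m : nat, exists2 l, (m <= l)%N & d (a ^+ l)%g 1%g <= r) ->
  exists M : R, forall k : nat, d (a ^+ k)%g 1%g <= M.
Proof.
case: (d_metric) => _ _ dC dtri ret0.
(* The net needs a positive radius, while [r] is arbitrary. *)
pose s := Num.max r 1.
have s0 : 0 < s by rewrite lt_max ltr01 orbT.
have ret m : exists2 l, (m <= l)%N & d (a ^+ l)%g 1%g <= s.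
  by have [l ml dl] := ret0 m; exists l; rewrite // le_max dl.
have [N netN] := finite_net_expg s s0.
have window k j : (k <= j)%N -> d (a ^+ j)%g 1%g <= s ->
    exists i, [/\ (k <= i)%N, (i <= k + N)%N & d (a ^+ i)%g 1%g <= s].
  elim/ltn_ind: j => j IH kj dj.
  have [jkN|jkN] := leqP j (k + N); first by exists j.
  have [|n [n0 nN djn]] := netN j _ dj; first lia.
  apply: (IH (j - n)%N); [lia|lia|].
  by rewrite -dist_expg //; lia.
(* With a return time [i] in [[k, k + N]], the distance from [a ^+ k] to [a ^+ i] is the term of
   index [i - k] in this sum. *)
exists (s + \sum_(i < N.+1) d (a ^+ i)%g 1%g) => k.
have [l kl dl] := ret k.
have [i [ki ikN di]] := window k l kl dl.
have iN : (i - k < N.+1)%N by lia.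
have dpos x y : 0 <= d x y.
  by have := dtri y x x; case: (d_metric) => d0 _ _ _; rewrite d0 (dC y x); lra.
apply: le_trans (dtri (a ^+ i)%g _ _) _; rewrite addrC lerD //.
rewrite dC dist_expg // (bigD1 (Ordinal iN)) //= lerDl.
exact: sumr_ge0.
Qed.

Lemma periodic_expg_return (r : R) :
  (forall m : nat, exists2 l, (m <= l)%N & d (a ^+ l)%g 1%g <= r) ->
  periodic_elt a.
Proof.
move=> /dist_expg_bounded [M HM].
case: (d_metric) => _ _ dC _.
apply: d_proper; first exact: closed_closure.
apply: (@dbounded_closure _ _ _ _ _ _ 1%g M) => // x [[n|n] _ <-] //=.
(* Right translation reduces a negative power to the positive one. *)
by rewrite -(d_right_invariant _ _ (a ^+ n.+1)%g) mulVg mul1g dC.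
Qed.

(** By right invariance [k * a ^+ l] is as far from [a ^+ l] as [k] is from 1, so [C] need not
    depend on [l]. *)
Lemma dist_expg_le_setdist (K K' : set G) :
  compact K -> compact K' ->
  exists C : R, forall (l : nat) (A : R),
    (setdist d (rtranslate K (a ^+ l)%g) K' < A%:E)%E ->
    d (a ^+ l)%g 1%g <= C + A.
Proof.
case: (d_metric) => _ _ dC dtri.
move=> /(compact_dist_le _ _ _ d_metric d_compatible _ 1%g) [C HC].
move=> /(compact_dist_le _ _ _ d_metric d_compatible _ 1%g) [C' HC'].
exists (C + C') => l A /ereal_inf_lt [_ [_ [k Kk <-] [k' Kk' <-]]].
rewrite lte_fin => dA.
have := d_right_invariant k 1%g (a ^+ l)%g; rewrite mul1g => dk.
have := dtri (k * a ^+ l)%g (a ^+ l)%g 1%g; rewrite (dC (a ^+ l)%g (k * _)%g) dk.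
have := dtri k' (k * a ^+ l)%g 1%g.
by have := HC _ Kk; have := HC' _ Kk'; lra.
Qed.

End RightInvariantMetric.

Theorem theorem2p14 (R : realType) (G : topologicalGroupType)
    (G_second_countable : @second_countable G)
    (G_locally_compact : locally_compact [set: G])
    (G_hausdorff : hausdorff_space G)
    (d : G -> G -> R)
    (d_metric : is_metric d)
    (d_right_invariant : right_invariant_metric d)
    (d_compatible : compatible_metric d)
    (d_proper : proper_metric d)
    (a : G) :
  aperiodic_elt a <->
  (forall K K' : set G, compact K -> compact K' ->
     setdist d (rtranslate K (a ^+ l)%g) K' @[l --> \oo] --> (+oo)%E).
Proof.
split=> [aper K K' cK cK'|div per].
  have [C HC] :=
    dist_expg_le_setdist R G d d_metric d_right_invariant d_compatible a K K' cK cK'.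
  apply/cvgeyPge => A; apply: contrapT => notnear.
  apply: aper; apply: (@periodic_expg_return _ _ d _ _ _ _ _ (C + A)) => // m.
  apply: contrapT => noret; apply: notnear.
  exists m => // l /= ml; rewrite leNgt; apply/negP => /HC dl.
  by apply: noret; exists l.
have /cvgeyPgt /(_ 0) [l _ /(_ l (leqnn l))] := div _ _ (@compact_set1 _ 1%g) per.
apply/negP; rewrite -leNgt.
have [d0 _ _ _] := d_metric.
(* [a ^+ l] lies in both sets, so their distance is at most 0. *)
apply: ereal_inf_lbound; exists (a ^+ l)%g.
  by exists 1%g; rewrite ?mul1g.
exists (a ^+ l)%g; last by rewrite d0.
by apply: subset_closure; exists (Posz l).
Qed.
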